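(* For every integer $m\geqslant 1$ there exist polynomials $Q^{[m]},R^{[m]}\in\mathbb{Q}[X]$, of degree $(m-2)^+$ and $(m-3)^+$ respectively, such that for every integer $n\geqslant 0$, with $p=\left\lfloor\frac{n+1}{2}\right\rfloor$, $$\sum_{i_1=0}^{\lfloor n/2\rfloor}\ \sum_{i_2=0}^{i_1}\cdots\sum_{i_m=0}^{i_{m-1}}\binom{n-i_1}{i_m}=F_{n+2m-1}-2^p\left(Q^{[m]}(p)+(-1)^nR^{[m]}(p)\right).$$
   Context: $(F_n)_{n\geqslant 0}$ denotes the Fibonacci numbers: $F_0=0$, $F_1=1$, and $F_{n+2}=F_{n+1}+F_n$ for all $n\geqslant 0$. For an integer $a$, $a^+=\frac12(a+|a|)=\max(a,0)$. The zero polynomial is regarded as having degree $0$. For $m=1$ the left-hand side is the single sum $\sum_{i_1=0}^{\lfloor n/2\rfloor}\binom{n-i_1}{i_1}$. The polynomials $Q^{[m]},R^{[m]}$ depend only on $m$, not on $n$. *)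

(* Defs.v *)
From mathcomp Require Import all_boot all_order all_algebra.

Set Implicit Arguments.
Unset Strict Implicit.
Unset Printing Implicit Defensive.

Fixpoint fib (n : nat) : nat :=
  match n with
  | 0 => 0
  | 1 => 1
  | (k.+1 as k1).+1 => fib k1 + fib k
  end.

(* nested_sum k f i =
     \sum_(0 <= j_1 <= i) \sum_(0 <= j_2 <= j_1) ... \sum_(0 <= j_k <= j_(k-1))
       f j_k,
   and f i itself when k = 0. *)
Fixpoint nested_sum (k : nat) (f : nat -> nat) (i : nat) : nat :=
  match k with
  | 0 => f i
  | k'.+1 => \sum_(0 <= j < i.+1) nested_sum k' f j
  end.

(* The size of 0 is 0, so the truncated predecessor gives the zero polynomial
   degree 0. *)
Definition deg (P : {poly rat}) : nat := (size P).-1.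

(* Main.v *)
Require Import Defs.
From mathcomp Require Import all_boot all_order all_algebra.
From mathcomp Require Import zify ring.
Import GRing.Theory.
Local Open Scope ring_scope.

(** Let T_k(N, i) be the k-fold iterated partial sum of the row C(N, .) up to i.
    The left-hand side for m = k + 1 is the diagonal sum
    S_k(n) = T_k(n, 0) + T_k(n - 1, 1) + ... + T_k(n - h, h), with h the integer
    part of n/2.  The proof is an induction on k.

    Base case: S_0(n) = F_(n+1) is the classical sum of binomial coefficients
    along a diagonal ([diag_fib]).

    Step: the defining relation
    T_(k+1)(N, i+1) = T_(k+1)(N, i) + T_k(N, i+1) and the Pascal rule, which
    every T_k inherits from the binomial coefficients, make the difference
    S_k(n+2) - S_(k+1)(n) telescope to the single term T_(k+1)(p, h+1) with
    p = n - h ([diag_step]).  Replacing n by n + 2 shifts the Fibonacci number by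
    two indices and p by one, so the polynomials for k + 1 are obtained from
    those for k by P(X) |-> 2 P(X + 1), plus the contribution of that term.

    The term is T_(k+1)(p, p+1) for n even and T_(k+1)(p, p) for n odd.  The same
    two relations determine both quantities, and show that in the Newton basis
    of the C(X, l) they are 2^p times polynomials in p with coefficients
    C(k+1, l+1) / 2^l and C(k, l) / 2^l ([nested_near_diag]).  Half the sum of
    the two polynomials goes into Q and half their difference into R.  The sum
    has size k + 1 and the difference has size k, while the shifted polynomials
    have sizes k and k - 1 (for k > 0); hence no leading term can cancel and the
    degrees are exact. *)

(** * Iterated partial sums of binomial rows *)

Lemma nested_sumS k f i :
  nested_sum k.+1 f i.+1 = (nested_sum k.+1 f i + nested_sum k f i.+1)%N.
Proof. by rewrite /= big_nat_recr. Qed.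

Lemma nested_sum0 k f : nested_sum k f 0 = f 0%N.
Proof. by elim: k => [|k IHk] //=; rewrite big_nat1. Qed.

Lemma nested_pascal k N i :
  nested_sum k (binomial N.+1) i.+1
    = (nested_sum k (binomial N) i.+1 + nested_sum k (binomial N) i)%N.
Proof.
elim: k i => [|k IHk] i; first by rewrite /= binS.
elim: i => [|i IHi].
  rewrite nested_sumS IHk !nested_sum0 nested_sumS !nested_sum0 !bin0; lia.
rewrite nested_sumS IHi IHk !nested_sumS; lia.
Qed.

(** * Diagonal sums *)

(** K may exceed the last index n/2 because the extra binomials vanish; this
    freedom lets both smaller sums in the Fibonacci recurrence take the range
    that the Pascal rule gives them. *)
Lemma diag_fib n K : (n < K.*2)%N ->
  (\sum_(0 <= i < K) 'C(n - i, i))%N = fib n.+1.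
Proof.
have [d] := ubnP n; elim: d n K => // d IHd [|[|n]] [|K] // lt_n_d lt_n_K;
  rewrite big_nat_recl // bin0.
- by rewrite big1.
- by rewrite big_nat_cond big1 // => i; rewrite subSS sub0n bin0n.
have -> : fib n.+3 = (fib n.+2 + fib n.+1)%N by [].
rewrite -(IHd n.+1 K.+1); [|lia|lia]; rewrite -(IHd n K); [|lia|lia].
rewrite [in RHS]big_nat_recl // bin0 -addnA -big_split /=; congr addn.
apply: eq_big_nat => i _; rewrite !subSS.
have [le_i_n|lt_n_i] := leqP i n; first by rewrite subSn // binS.
have -> : (n.+1 - i)%N = 0%N by lia.
have -> : (n - i)%N = 0%N by lia.
by rewrite !bin0n; lia.
Qed.

(** The difference of the two sums telescopes as K grows: by [nested_sumS] and
    [nested_pascal], the boundary term on the right absorbs the new term on the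
    left and releases the new term of the other sum. *)
Lemma diag_step k n K : (K <= n.+1)%N ->
  (\sum_(0 <= i < K.+1) nested_sum k (binomial (n.+2 - i)) i
    = \sum_(0 <= i < K) nested_sum k.+1 (binomial (n - i)) i
      + nested_sum k.+1 (binomial (n.+1 - K)) K)%N.
Proof.
elim: K => [|K IHK] le_K_n.
  by rewrite big_nat1 big_nil !nested_sum0 !bin0.
have := nested_sumS k (binomial (n - K).+1) K; rewrite [LHS]nested_pascal => stepK.
rewrite big_nat_recr // IHK; last by lia.
rewrite [in RHS]big_nat_recr // !subSS subSn //.
rewrite -[LHS]/(_ + _)%N -[RHS]/(\sum_(0 <= i < K) _ + _ + _)%N.
by rewrite -!addnA -stepK; congr (_ + _)%N; apply: addnC.
Qed.

(** * Newton expansions *)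

(** The binomial coefficient C(X, l) as a polynomial in X. *)
Fixpoint binpoly (l : nat) : {poly rat} :=
  if l is l'.+1 then l'.+1%:R^-1 *: (binpoly l' * ('X - (l'%:R)%:P)) else 1.

Lemma horner_binpoly l q : (binpoly l).[q%:R] = 'C(q, l)%:R.
Proof.
elim: l => [|l IHl]; first by rewrite /= hornerE bin0.
rewrite /= hornerZ hornerM IHl hornerXsubC.
have l1_neq0 : (l.+1%:R : rat) != 0 by rewrite Num.Theory.pnatr_eq0.
apply: (mulfI l1_neq0); rewrite mulVKf // -natrM mul_bin_left.
have [le_l_q|lt_q_l] := leqP l q; first by rewrite natrM natrB // mulrC.
by rewrite bin_small // muln0 mul0r.
Qed.

Lemma size_binpoly l : size (binpoly l) = l.+1.
Proof.
elim: l => [|l IHl] /=; first by rewrite size_poly1.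
rewrite size_scale ?invr_eq0 ?Num.Theory.pnatr_eq0 //.
by rewrite size_Mmonic ?monicXsubC -?size_poly_eq0 ?IHl // size_XsubC addn2.
Qed.

(** The weights come from the identity
    C(q, 0) C(0, l) + ... + C(q, q) C(q, l) = 2^q C(q, l) / 2^l: up to the factor
    2^q, summing a binomial row against C(., l) gives C(q, l) / 2^l. *)
Definition newton (c : nat -> nat) (d : nat) : {poly rat} :=
  \sum_(0 <= l < d) ((c l)%:R / 2 ^+ l) *: binpoly l.

Lemma horner_newton c d q :
  (newton c d).[q%:R] = \sum_(0 <= l < d) (c l)%:R / 2 ^+ l * 'C(q, l)%:R.
Proof.
by rewrite horner_sum; apply: eq_bigr => l _; rewrite hornerZ horner_binpoly.
Qed.

Lemma size_newton_le c d : (size (newton c d) <= d)%N.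
Proof.
rewrite /newton big_mkord; apply: (leq_trans (size_sum _ _ _)).
by apply/bigmax_leqP => l _; rewrite (leq_trans (size_scale_leq _ _)) ?size_binpoly.
Qed.

Lemma size_newton c d : c d != 0%N -> size (newton c d.+1) = d.+1.
Proof.
move=> cd_neq0; have wd_neq0 : (c d)%:R / 2 ^+ d != 0 :> rat.
  by rewrite mulf_neq0 ?invr_neq0 ?expf_neq0 ?Num.Theory.pnatr_eq0.
rewrite /newton big_nat_recr //= addrC size_polyDl size_scale // size_binpoly //.
by rewrite ltnS size_newton_le.
Qed.

Lemma newtonD c1 c2 d :
  newton c1 d + newton c2 d = newton (fun l => c1 l + c2 l)%N d.
Proof.
by rewrite -big_split /=; apply: eq_bigr => l _; rewrite -scalerDl -mulrDl -natrD.
Qed.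

(** The Pascal rule makes differencing shift Newton coefficients by one place;
    the factor 2 compensates the change of weight from 1/2^l to 1/2^(l+1). *)
Lemma newton_diff c d q :
  2 * (newton c d.+1).[q.+1%:R]
    = 2 * (newton c d.+1).[q%:R] + (newton (fun l => c l.+1) d).[q%:R].
Proof.
rewrite !horner_newton big_nat_recl // [in RHS]big_nat_recl // !bin0.
rewrite !mulrDr -!addrA; congr (_ + _).
rewrite !mulr_sumr -big_split; apply: eq_bigr => l _ /=.
have two_neq0 : (2 ^+ l : rat) != 0 by rewrite expf_neq0.
by rewrite binS natrD exprS; field.
Qed.

Lemma newton_pascal k :
  newton (fun l => 'C(k.+1, l.+1)) k.+1
    = newton (fun l => 'C(k, l.+1)) k + newton (binomial k) k.+1.
Proof.
have -> : newton (fun l => 'C(k, l.+1)) k = newton (fun l => 'C(k, l.+1)) k.+1.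
  by rewrite [RHS]/newton big_nat_recr //= bin_small // mul0r scale0r addr0.
by rewrite newtonD; apply: eq_bigr => l _; rewrite binS.
Qed.

(** * Partial sums at the end of a row *)

(** Let g_j(r) = T_j(r, r+1) and h_j(r) = T_(j+1)(r, r), where T_j(r, i) is the
    j-fold partial sum of the row C(r, .) up to i.  Then g_(j+1) = g_j + h_j by
    the definition of nested sums, and h_j(r+1) = 2 h_j(r) + g_j(r) by the Pascal
    rule.  The right-hand sides satisfy the same recurrences: these are
    [newton_pascal] and [newton_diff]. *)
Lemma nested_near_diag k q :
  (nested_sum k.+1 (binomial q) q)%:R
    = 2 ^+ q * (newton (binomial k) k.+1).[q%:R] :> rat
  /\ (nested_sum k.+1 (binomial q) q.+1)%:R
    = 2 ^+ q * (newton (fun l => 'C(k.+1, l.+1)) k.+1).[q%:R] :> rat.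
Proof.
(* The claimed closed forms of g_j(r) and h_j(r). *)
pose g j r := 2 ^+ r * (newton (fun l => 'C(j, l.+1)) j).[r%:R] : rat.
pose h j r := 2 ^+ r * (newton (binomial j) j.+1).[r%:R] : rat.
have gS j r : g j.+1 r = h j r + g j r.
  rewrite /g /h -mulrDr -hornerD; congr (_ * _.[_]).
  by rewrite newton_pascal addrC.
have h0 j : h j 0%N = 1.
  rewrite /h expr0 mul1r horner_newton big_nat_recl // big1 ?addr0 ?bin0 //.
  by move=> l _; rewrite bin0n mulr0.
have hS j r : h j r.+1 = 2 * h j r + g j r.
  rewrite /h /g exprS [2 * 2 ^+ r]mulrC -mulrA newton_diff; ring.
suff H j : (forall r, (nested_sum j (binomial r) r.+1)%:R = g j r)
    /\ (forall r, (nested_sum j.+1 (binomial r) r)%:R = h j r).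
  by split; [apply: (H k).2 | apply: (H k.+1).1].
have to_h i : (forall r, (nested_sum i (binomial r) r.+1)%:R = g i r) ->
    forall r, (nested_sum i.+1 (binomial r) r)%:R = h i r.
  move=> Hg; elim=> [|r IHr]; first by rewrite nested_sum0 bin0 h0.
  by rewrite nested_pascal nested_sumS !natrD IHr Hg hS; ring.
elim: j => [|j [IHg IHh]].
  have Hg r : (nested_sum 0 (binomial r) r.+1)%:R = g 0%N r.
    by rewrite /= bin_small // /g /newton big_nil horner0 mulr0.
  by split=> //; apply: to_h.
have Hg r : (nested_sum j.+1 (binomial r) r.+1)%:R = g j.+1 r.
  by rewrite nested_sumS natrD IHh IHg gS.
by split=> //; apply: to_h.
Qed.

(** * The induction on the number of nested sums *)

(** The two parities of n call for the two values of [nested_near_diag]; a single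
    formula covers them by taking half the sum and half the difference of the two
    expansions.  The difference simplifies by C(k+1, l+1) - C(k, l) = C(k, l+1). *)
Lemma boundary_term k n (p := ((n + 1) %/ 2)%N) :
  (nested_sum k.+1 (binomial p) (n %/ 2).+1)%:R
  = 2 ^+ p * (2^-1 * (newton (fun l => 'C(k.+1, l.+1) + 'C(k, l))%N k.+1).[p%:R]
     + (-1) ^+ n * (2^-1 * (newton (fun l => 'C(k, l.+1)) k).[p%:R])) :> rat.
Proof.
have [Hodd Heven] := nested_near_diag k p.
rewrite -newtonD hornerD -signr_odd.
case: (boolP (odd n)) => odd_n.
  have -> : (n %/ 2).+1 = p by rewrite /p; lia.
  rewrite Hodd newton_pascal hornerD expr1; by field.
have -> : (n %/ 2)%N = p by rewrite /p; lia.
rewrite Heven newton_pascal hornerD expr0; by field.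
Qed.

Lemma size_shift2 (P : {poly rat}) : size (2 *: (P \Po ('X + 1%:P))) = size P.
Proof. by rewrite size_scale // size_comp_poly2 // size_XaddC. Qed.

Lemma horner_shift2 (P : {poly rat}) p :
  (2 *: (P \Po ('X + 1%:P))).[p%:R] = 2 * P.[p.+1%:R].
Proof. by rewrite hornerZ horner_comp !hornerE natr1. Qed.

(** The theorem with m = k + 1, recording sizes instead of degrees: a size still
    bounds the coefficients when the polynomial is 0, as the induction needs when
    it adds a leading term to a zero polynomial. *)
Lemma diag_sum_fib k : exists Q R : {poly rat},
  [/\ size Q = k, size R = k.-1
    & forall n : nat, let p := ((n + 1) %/ 2)%N in
      (\sum_(0 <= i < (n %/ 2).+1) nested_sum k (binomial (n - i)) i)%N%:R
      = (fib (n + 2 * k).+1)%:R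
        - 2 ^+ p * (Q.[p%:R] + (-1) ^+ n * R.[p%:R]) :> rat].
Proof.
elim: k => [|k [Q [R [sQ sR IH]]]].
  exists 0, 0; split=> [||n p]; rewrite ?size_poly0 //.
  rewrite diag_fib; last by lia.
  by rewrite muln0 addn0 !horner0 mulr0 addr0 mulr0 subr0.
exists (2^-1 *: newton (fun l => 'C(k.+1, l.+1) + 'C(k, l))%N k.+1
        + 2 *: (Q \Po ('X + 1%:P))),
  (2^-1 *: newton (fun l => 'C(k, l.+1)) k + 2 *: (R \Po ('X + 1%:P))).
split=> [||n p].
- have sN : size (2^-1 *: newton (fun l => 'C(k.+1, l.+1) + 'C(k, l))%N k.+1) = k.+1.
    by rewrite size_scale // size_newton // !binn.
  by rewrite size_polyDl sN // size_shift2 sQ.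
- case: k sR {sQ IH} => [|k] /= sR.
    by rewrite /newton big_nil scaler0 add0r size_shift2.
  have sN : size (2^-1 *: newton (fun l => 'C(k.+1, l.+1)) k.+1) = k.+1.
    by rewrite size_scale // size_newton // binn.
  by rewrite size_polyDl sN // size_shift2 sR.
(* The row n + 2 for k yields the row n for k + 1. *)
have := IH n.+2; cbv zeta.
have -> : (n.+2 %/ 2)%N = (n %/ 2).+1 by lia.
have -> : ((n.+2 + 1) %/ 2)%N = p.+1 by rewrite /p; lia.
rewrite diag_step; last by lia.
have -> : (n.+1 - (n %/ 2).+1)%N = p by rewrite /p; lia.
have -> : (n.+2 + 2 * k).+1 = (n + 2 * k.+1).+1 by lia.
rewrite natrD boundary_term -/p => /(canRL (addrK _)) ->.
rewrite !hornerD !horner_shift2 !hornerZ !exprS; ring.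
Qed.

(* Truncated subtraction on nat is the positive part: (m - k)%N = (m - k)^+. *)
Theorem theorem6 (m : nat) (hm : (1 <= m)%N) :
  exists Q R : {poly rat},
    [/\ deg Q = (m - 2)%N,
        deg R = (m - 3)%N
      & forall n : nat,
          let p := ((n + 1) %/ 2)%N in
          (\sum_(0 <= i1 < (n %/ 2).+1)
              nested_sum (m - 1) (fun im => 'C(n - i1, im)) i1)%N%:R
          = (fib (n + 2 * m - 1))%:R
            - 2 ^+ p * (Q.[p%:R] + (-1) ^+ n * R.[p%:R]) :> rat].
Proof.
case: m hm => // k _; have [Q [R [sQ sR H]]] := diag_sum_fib k.
exists Q, R; split=> [||n p]; rewrite /deg ?sQ ?sR; try lia.
have -> : (n + 2 * k.+1 - 1)%N = (n + 2 * k).+1 by lia.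
by rewrite subn1; apply: H.
Qed.
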